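(* Let $g(z)=z+b_2z^2+b_3z^3+\cdots\in\mathcal{S}^*$ satisfy $$6|b_2|^3-4|b_2|(|b_3|-1)-4(|b_3|-1)^2+|b_2|^2(3|b_3|+5)\ge 0,$$ and let $f\in\mathcal{K}$ be close-to-convex with respect to $g$, i.e. $f\in\mathcal{A}$ and $\mathrm{Re}\left(zf'(z)/g(z)\right)>0$ for $z\in\mathbb{D}$. Then the following hold. (1) $1-\left(1+\dfrac{|b_2|}{2}\right)^2\le\det T_{2,1}(f)\le 1$. (2) If $6|b_2|^3+|b_2|^2(3|b_3|+13)+4|b_2|(|b_3|-1)-2(1-|b_3|)^2-18\le 0$, then $\det T_{3,1}(f)\le 1$. (3) If $6|b_2|^3+|b_2|^2(3|b_3|+13)+4|b_2|(|b_3|-1)-2(1-|b_3|)^2-18>0$, then $$\det T_{3,1}(f)\le\frac{1}{18}\left(6|b_2|^3+|b_2|^2(3|b_3|+13)+4|b_2|(|b_3|-1)-2(1-|b_3|)^2\right).$$ All these bounds are sharp.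
   Context: $\mathbb{D}=\{z\in\mathbb{C}:|z|<1\}$. $\mathcal{A}$ is the class of analytic functions $f(z)=z+a_2z^2+a_3z^3+\cdots$ on $\mathbb{D}$. $\mathcal{S}^*$ is the class of starlike functions, i.e. univalent $g\in\mathcal{A}$ with $\mathrm{Re}(zg'(z)/g(z))>0$ on $\mathbb{D}$. $\mathcal{K}$ is the class of close-to-convex functions: $f\in\mathcal{A}$ such that $\mathrm{Re}(zf'(z)/g(z))>0$ on $\mathbb{D}$ for some $g\in\mathcal{S}^*$. For $f(z)=z+a_2z^2+a_3z^3+\cdots$, the second and third order Hermitian–Toeplitz determinants are $$\det T_{2,1}(f)=1-|a_2|^2,\qquad \det T_{3,1}(f)=\begin{vmatrix}1&a_2&a_3\\ \bar a_2&1&a_2\\ \bar a_3&\bar a_2&1\end{vmatrix}=2\,\mathrm{Re}(a_2^2\bar a_3)-2|a_2|^2-|a_3|^2+1.$$ A bound is sharp if there is a pair $(f,g)$ satisfying the hypotheses for which equality holds in it. *)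

(* Defs.v *)
(* Stdlib reals with Coquelicot's complex numbers. *)
From Stdlib Require Import Reals Lra Lia Arith.
From Coquelicot Require Import Coquelicot.
Open Scope R_scope.

Definition in_disc (z : C) : Prop := Cmod z < 1.

Definition holomorphic_on_disc (f : C -> C) : Prop :=
  forall z : C, in_disc z -> @ex_derive C_AbsRing C_NormedModule f z.

(* [class_A f a]: f is analytic on the unit disc, with Maclaurin expansion
   f(z) = z + a_2 z^2 + a_3 z^3 + ... there.  The values of f outside the disc
   are irrelevant.  The coefficient sequence is an explicit argument so that
   the coefficients of f can be mentioned; it is determined by f. *)
Definition class_A (f : C -> C) (a : nat -> C) : Prop :=
  holomorphic_on_disc f /\
  a 0%nat = RtoC 0 /\ a 1%nat = RtoC 1 /\
  forall z : C, in_disc z -> @is_pseries C_AbsRing C_NormedModule a z (f z).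

Definition univalent (f : C -> C) : Prop :=
  forall z w : C, in_disc z -> in_disc w -> f z = f w -> z = w.

(* Re (z f'(z) / g(z)) > 0 on the disc.  For f and g normalised as in
   [class_A], the quotient has a removable singularity at 0 with value 1, so
   the condition holds trivially there; the formula is imposed for z <> 0, the
   total division of [C] giving 0 at the origin.
   [C_derive f z] is the complex derivative wherever f is complex
   differentiable, see [is_C_derive_unique]. *)
Definition pos_real_quotient (f g : C -> C) : Prop :=
  forall z : C, in_disc z -> z <> RtoC 0 -> 0 < Re (z * C_derive f z / g z)%C.

Definition starlike (g : C -> C) (b : nat -> C) : Prop :=
  class_A g b /\ univalent g /\ pos_real_quotient g g.

Definition close_to_convex_wrt (f : C -> C) (a : nat -> C) (g : C -> C) : Prop :=
  class_A f a /\ pos_real_quotient f g.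

(* Determinant of the matrix (M i j), 0 <= i, j < n, by Laplace expansion along
   the first row.  The bound of [sum_n] is inclusive. *)
Fixpoint Cdet (n : nat) (M : nat -> nat -> C) : C :=
  match n with
  | O => RtoC 1
  | S m =>
      @sum_n C_AbelianMonoid
        (fun j => (RtoC (-1) ^ j * M 0%nat j
           * Cdet m (fun i k => M (S i) (if (k <? j)%nat then k else S k)))%C) m
  end.

(* The Hermitian-Toeplitz determinant of order q with first row
   a_n, a_{n+1}, ..., a_{n+q-1}. *)
Definition toeplitz (n : nat) (a : nat -> C) (i j : nat) : C :=
  if (i <=? j)%nat then a (n + (j - i))%nat else Cconj (a (n + (i - j))%nat).

Definition det_T (q n : nat) (a : nat -> C) : C := Cdet q (toeplitz n a).

(* When a_1 = 1 both determinants below are real, so taking [Re] of them loses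
   no information. *)
Lemma det_T_2_1 (a : nat -> C) (a1 : a 1%nat = RtoC 1) :
  det_T 2 1 a = RtoC (1 - Cmod (a 2%nat) ^ 2).
Proof.
rewrite RtoC_minus, Cmod2_conj.
unfold det_T; cbn [Cdet]; repeat rewrite ?sum_Sn, ?sum_O; cbn [Cdet].
repeat change (@plus C_AbelianMonoid) with Cplus.
unfold toeplitz; simpl; rewrite ?a1.
apply injective_projections; simpl; ring.
Qed.

Lemma det_T_3_1 (a : nat -> C) (a1 : a 1%nat = RtoC 1) :
  det_T 3 1 a =
  RtoC (2 * Re (a 2%nat ^ 2 * Cconj (a 3%nat))%C
        - 2 * Cmod (a 2%nat) ^ 2 - Cmod (a 3%nat) ^ 2 + 1).
Proof.
rewrite RtoC_plus, !RtoC_minus, !RtoC_mult, !Cmod2_conj.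
unfold det_T; cbn [Cdet]; repeat rewrite ?sum_Sn, ?sum_O; cbn [Cdet].
repeat change (@plus C_AbelianMonoid) with Cplus.
unfold toeplitz; simpl; rewrite ?a1.
apply injective_projections; simpl; ring.
Qed.

(* The standing inequality on g, with x = |b_2| and y = |b_3|. *)
Definition standing_ineq (x y : R) : Prop :=
  0 <= 6 * x ^ 3 - 4 * x * (y - 1) - 4 * (y - 1) ^ 2 + x ^ 2 * (3 * y + 5).

(* The quantity whose comparison with 18 separates the two upper bounds for the
   third order determinant. *)
Definition Phi (x y : R) : R :=
  6 * x ^ 3 + x ^ 2 * (3 * y + 13) + 4 * x * (y - 1) - 2 * (1 - y) ^ 2.

Definition admissible (f : C -> C) (a : nat -> C) (g : C -> C) (b : nat -> C)
  : Prop :=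
  starlike g b /\
  standing_ineq (Cmod (b 2%nat)) (Cmod (b 3%nat)) /\
  close_to_convex_wrt f a g.

(* Main.v *)
Require Import Defs.
From Stdlib Require Import Reals Lra Lia.
From Coquelicot Require Import Coquelicot.
Open Scope R_scope.

(** Write z f' = g p with p = 1 + c_1 z + c_2 z^2 + ... of positive real part, so
    that 2 a_2 = b_2 + c_1 and 3 a_3 = b_3 + b_2 c_1 + c_2. Everything rests on the
    Caratheodory inequalities |c_1| <= 2 and |c_2| <= 2. They give
    |a_2| <= 1 + x/2 and |a_3| <= S = (y + 2x + 2)/3, where x = |b_2| and
    y = |b_3|, and the bounds on 1 - |a_2|^2 follow at once.

    The third determinant is at most 1 + 2 u^2 (v - 1) - v^2, where u = |a_2| and
    v = |a_3|. This is at most 1 when v <= 1; when v > 1 it increases with u, so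
    u^2 may be replaced by A = (1 + x/2)^2, and then it increases with v as long
    as v <= A. The standing inequality factors as (2x + y - 1) times
    (3x^2 + 4x + 4 - 4y), that is, up to a positive constant, as (S - 1)(A - S).
    Hence either S <= 1, and v <= 1, or v <= S <= A, and the value at u^2 = A and
    v = S, which is Phi x y / 18, is an upper bound ([det_majorant_le]).

    For the Caratheodory inequalities, let P = 1 + z^n k have positive real part.
    Its Cayley transform (P - 1)/(P + 1) = z^n h is bounded by 1, so |h| <= r^(-n)
    on the circle of radius r, and therefore |k(0)| / 2 = |h(0)| <= 1
    ([coefficient_le_2]). The passage from the circle to its centre is the mean
    value property ([mean_value_property]), obtained by differentiating the
    circular mean of Re h with respect to the radius: by the Cauchy-Riemann
    equations the result is the integral of an angular derivative, hence 0. This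
    asks only for two complex derivatives, which p = f' / (g/z) has because f' and
    g/z are sums of power series ([smooth_on_disc_Csum]) and g/z has no zero. The
    choice P = p gives c_1, and P(z) = (p(z) + p(-z))/2 gives c_2.

    Equality holds for f = g = z/(1 - z)^2 in the lower bound on the second
    determinant and in the larger upper bound on the third, and for f = z and
    g = z/(1 - z^2) in the two upper bounds equal to 1. *)

(** * Complex differentiation *)

Notation is_derive_C := (@is_derive C_AbsRing C_NormedModule).
Notation is_pseries_C := (@is_pseries C_AbsRing C_NormedModule).

Lemma locally_C_AbsRing (z : C) (P : C -> Prop) :
  @locally (AbsRing_UniformSpace C_AbsRing) z P <->
  exists d : posreal, forall w : C, Cmod (w - z) < d -> P w.
Proof. split; intros [d H]; exists d; exact H. Qed.

(** The ball of the uniform structure that [C] carries as a normed module is a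
    square, the one coming from its absolute value is a round disc; stating the
    derivative with [Cmod] alone removes this ambiguity once and for all. *)
Lemma is_derive_C_iff (h : C -> C) (z l : C) :
  is_derive_C h z l <->
  forall eps : posreal, exists d : posreal, forall w : C, Cmod (w - z) < d ->
    Cmod (h w - h z - (w - z) * l)%C <= eps * Cmod (w - z).
Proof.
split.
- intros [_ H] eps.
  assert (Hz : @is_filter_lim C_NormedModule
    (@locally (AbsRing_UniformSpace C_AbsRing) z) z).
  { intros P HP. apply locally_C. exact HP. }
  specialize (H z (fun P HP => HP) eps).
  apply (proj1 (locally_C_AbsRing z _)) in H. destruct H as [d Hd].
  exists d. intros w Hw. exact (Hd w Hw).
- intros H. split.
  + apply @is_linear_scal_l.
  + intros x Hx eps.
    assert (Ex : z = x).
    { apply (@is_filter_lim_locally_unique C_AbsRing (AbsRing_NormedModule C_AbsRing)). exact Hx. }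
    subst x. destruct (H eps) as [d Hd].
    apply (proj2 (locally_C_AbsRing z _)). exists d. intros w Hw. exact (Hd w Hw).
Qed.

(** Inversion and power series are differentiated through this criterion: in both
    cases the remainder of the first order expansion is an explicit multiple of
    the square of the increment. *)
Lemma is_derive_C_quadratic (h : C -> C) (z l : C) (M d : R) :
  0 < d ->
  (forall w : C, Cmod (w - z) < d ->
     Cmod (h w - h z - (w - z) * l)%C <= M * Cmod (w - z) ^ 2) ->
  is_derive_C h z l.
Proof.
intros Hd H. apply is_derive_C_iff. intros eps.
assert (HM : 0 < Rabs M + 1) by (pose proof (Rabs_pos M); lra).
assert (He : 0 < eps / (Rabs M + 1)) by (apply Rdiv_lt_0_compat; [apply cond_pos | lra]).
exists (mkposreal _ (Rmin_stable_in_posreal (mkposreal d Hd) (mkposreal _ He))).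
simpl. intros w Hw.
pose proof (Rmin_l d (eps / (Rabs M + 1))).
pose proof (Rmin_r d (eps / (Rabs M + 1))).
apply Rle_trans with (1 := H w ltac:(lra)).
pose proof (Cmod_ge_0 (w - z)). pose proof (Rle_abs M).
assert ((Rabs M + 1) * Cmod (w - z) <= eps).
{ apply Rle_trans with ((Rabs M + 1) * (eps / (Rabs M + 1))).
  apply Rmult_le_compat_l; lra. apply Req_le. field. lra. }
simpl. nra.
Qed.

Lemma is_derive_C_mult (f g : C -> C) (z df dg : C) :
  is_derive_C f z df -> is_derive_C g z dg ->
  is_derive_C (fun w => (f w * g w)%C) z (df * g z + f z * dg)%C.
Proof.
intros Hf Hg.
(* [is_derive_mult] concerns functions valued in the absolute ring, whose normed
   module structure differs from [C_NormedModule] although both have the same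
   norm. *)
assert (T : forall h l, is_derive_C h z l <->
  @is_derive C_AbsRing (AbsRing_NormedModule C_AbsRing) h z l).
{ intros h l. split; intros [_ H]; (split; [apply @is_linear_scal_l | exact H]). }
apply T. apply @is_derive_mult; [now apply T | now apply T | exact Cmult_comm].
Qed.

Lemma is_derive_C_inv (z : C) : z <> 0%C ->
  is_derive_C Cinv z (- / z * / z)%C.
Proof.
intros Hz.
pose proof (proj1 (Cmod_gt_0 z) Hz) as Hm.
apply is_derive_C_quadratic with (M := 2 / Cmod z ^ 3) (d := Cmod z / 2).
lra. intros w Hw.
assert (Hwm : Cmod z / 2 < Cmod w).
{ pose proof (Cmod_triangle w (- (w - z))) as T.
  replace (w + - (w - z))%C with z in T by ring. rewrite Cmod_opp in T. lra. }
assert (Hw0 : w <> 0%C) by (apply Cmod_gt_0; lra).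
replace (/ w - / z - (w - z) * (- / z * / z))%C with ((w - z) ^ 2 * (/ w * / z ^ 2))%C
  by (field; auto).
rewrite Cmod_mult, Cmod_pow, Rmult_comm. apply Rmult_le_compat_r. apply pow2_ge_0.
rewrite Cmod_mult, !Cmod_inv, Cmod_pow; auto.
2: { simpl. rewrite Cmult_1_r. now apply Cmult_neq_0. }
apply Rle_trans with (/ (Cmod z / 2) * / Cmod z ^ 2).
- apply Rmult_le_compat_r. left. apply Rinv_0_lt_compat. now apply pow_lt.
  apply Rinv_le_contravar; lra.
- apply Req_le. field. lra.
Qed.

Lemma is_derive_C_id (z : C) : is_derive_C (fun w => w) z (RtoC 1).
Proof.
apply is_derive_C_quadratic with (M := 0) (d := 1). lra.
intros w _. replace (w - z - (w - z) * 1)%C with (RtoC 0) by ring. rewrite Cmod_0. lra.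
Qed.

Lemma is_derive_C_recip (h : C -> C) (z l : C) : is_derive_C h z l -> h z <> 0%C ->
  is_derive_C (fun w => (/ h w)%C) z (l * (- / h z * / h z))%C.
Proof.
intros H H0. apply (@is_derive_comp C_AbsRing C_NormedModule Cinv h).
- now apply is_derive_C_inv.
- destruct H as [_ H]. split; [apply @is_linear_scal_l | exact H].
Qed.

Lemma in_disc_open (z : C) : in_disc z ->
  @locally (AbsRing_UniformSpace C_AbsRing) z in_disc.
Proof.
intros Hz. apply locally_C_AbsRing.
assert (H : 0 < 1 - Cmod z) by (unfold in_disc in Hz; lra).
exists (mkposreal _ H). simpl. intros w Hw.
unfold in_disc. pose proof (Cmod_triangle z (w - z)) as T.
replace (z + (w - z))%C with w in T by ring. lra.
Qed.

(** Only two derivatives are ever used, but counting them makes the stability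
    under products and inverses an induction: the derivative of a product or of
    an inverse is again built from functions with one derivative less. *)
Fixpoint smooth_on_disc (n : nat) (h : C -> C) : Prop :=
  match n with
  | O => True
  | S m => exists h' : C -> C,
      (forall z, in_disc z -> is_derive_C h z (h' z)) /\ smooth_on_disc m h'
  end.

Lemma smooth_on_disc_pred n : forall h, smooth_on_disc (S n) h -> smooth_on_disc n h.
Proof.
induction n as [|n IH]; intros h [h' [H1 H2]]; [exact I|].
exists h'. split; [exact H1 | now apply IH].
Qed.

Lemma smooth_on_disc_ext n h k : (forall z, in_disc z -> h z = k z) ->
  smooth_on_disc n h -> smooth_on_disc n k.
Proof.
destruct n as [|n]; [easy|]. intros E [h' [H1 H2]]. exists h'. split; [|exact H2].
intros z Hz. apply is_derive_ext_loc with h; [|now apply H1].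
apply filter_imp with (2 := in_disc_open z Hz). exact E.
Qed.

Lemma smooth_on_disc_const n : forall c, smooth_on_disc n (fun _ => c).
Proof.
induction n as [|n IH]; intros c; [exact I|].
exists (fun _ => 0%C). split; [|apply IH].
intros z _. exact (@is_derive_const C_AbsRing C_NormedModule c z).
Qed.

Lemma smooth_on_disc_id n : smooth_on_disc n (fun z => z).
Proof.
destruct n as [|n]; [exact I|].
exists (fun _ => 1%C). split; [|apply smooth_on_disc_const].
intros z _. apply is_derive_C_id.
Qed.

Lemma smooth_on_disc_plus n : forall h k, smooth_on_disc n h -> smooth_on_disc n k ->
  smooth_on_disc n (fun z => (h z + k z)%C).
Proof.
induction n as [|n IH]; intros h k Hh Hk; [exact I|].
destruct Hh as [h' [Hh Hh']], Hk as [k' [Hk Hk']].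
exists (fun z => (h' z + k' z)%C). split; [|now apply IH].
intros z Hz. apply @is_derive_plus; auto.
Qed.

Lemma smooth_on_disc_mult n : forall h k, smooth_on_disc n h -> smooth_on_disc n k ->
  smooth_on_disc n (fun z => (h z * k z)%C).
Proof.
induction n as [|n IH]; intros h k Hh Hk; [exact I|].
pose proof (smooth_on_disc_pred n h Hh) as Hh0.
pose proof (smooth_on_disc_pred n k Hk) as Hk0.
destruct Hh as [h' [Hh Hh']], Hk as [k' [Hk Hk']].
exists (fun z => (h' z * k z + h z * k' z)%C). split.
- intros z Hz. apply is_derive_C_mult; auto.
- apply smooth_on_disc_plus; now apply IH.
Qed.

Lemma smooth_on_disc_opp n h : smooth_on_disc n h -> smooth_on_disc n (fun z => (- h z)%C).
Proof.
intros H. apply smooth_on_disc_ext with (fun z => (- (1) * h z)%C).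
- intros z _. ring.
- apply smooth_on_disc_mult; [apply smooth_on_disc_const | exact H].
Qed.

Lemma smooth_on_disc_minus n h k : smooth_on_disc n h -> smooth_on_disc n k ->
  smooth_on_disc n (fun z => (h z - k z)%C).
Proof.
intros Hh Hk. apply smooth_on_disc_plus; [exact Hh | now apply smooth_on_disc_opp].
Qed.

Lemma smooth_on_disc_inv n : forall h, smooth_on_disc n h ->
  (forall z, in_disc z -> h z <> 0%C) -> smooth_on_disc n (fun z => (/ h z)%C).
Proof.
induction n as [|n IH]; intros h Hh H0; [exact I|].
pose proof (smooth_on_disc_pred n h Hh) as Hh0.
destruct Hh as [h' [Hh Hh']].
exists (fun z => (h' z * (- / h z * / h z))%C). split.
- intros z Hz. apply is_derive_C_recip; [now apply Hh | now apply H0].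
- apply smooth_on_disc_mult; [exact Hh'|].
  apply smooth_on_disc_mult; [apply smooth_on_disc_opp|]; now apply IH.
Qed.

Lemma smooth_on_disc_div n h k : smooth_on_disc n h -> smooth_on_disc n k ->
  (forall z, in_disc z -> k z <> 0%C) -> smooth_on_disc n (fun z => (h z / k z)%C).
Proof.
intros Hh Hk H0. apply smooth_on_disc_mult; [exact Hh | now apply smooth_on_disc_inv].
Qed.

Lemma smooth_on_disc_reflect n : forall h, smooth_on_disc n h ->
  smooth_on_disc n (fun z => h (- z)%C).
Proof.
induction n as [|n IH]; intros h Hh; [exact I|].
destruct Hh as [h' [Hh Hh']].
exists (fun z => (- h' (- z))%C). split.
- intros z Hz.
  assert (Hz' : in_disc (- z)) by (unfold in_disc; now rewrite Cmod_opp).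
  apply is_derive_C_iff. intros eps.
  destruct (proj1 (is_derive_C_iff _ _ _) (Hh _ Hz') eps) as [d Hd].
  exists d. intros w Hw.
  assert (E : Cmod (- w - - z) = Cmod (w - z)).
  { rewrite <- Cmod_opp. f_equal. ring. }
  specialize (Hd (- w)%C). rewrite E in Hd. specialize (Hd Hw).
  replace ((w - z) * - h' (- z))%C with ((- w - - z) * h' (- z))%C by ring. exact Hd.
- apply smooth_on_disc_opp. now apply IH.
Qed.

Lemma smooth_on_disc_pow n m : smooth_on_disc n (fun z => (z ^ m)%C).
Proof.
induction m as [|m IH]; [exact (smooth_on_disc_const n 1%C)|].
exact (smooth_on_disc_mult n _ _ (smooth_on_disc_id n) IH).
Qed.

(** * Power series on the unit disc *)

Notation is_series_C := (@is_series C_AbsRing C_NormedModule).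

(* Limits of complex series live in a normed module whose carrier has to be
   unfolded to [C] before the ring structure is recognised. *)
Ltac ring_C := lazymatch goal with |- @eq _ ?x ?y => change (@eq C x y) end; ring.

Definition converges_on_disc (a : nat -> C) : Prop :=
  forall z, in_disc z -> exists l, is_pseries_C a z l.

Definition Csum (a : nat -> C) (z : C) : C :=
  @iota C_CompleteNormedModule (fun l => is_pseries_C a z l).

Definition Cshift (a : nat -> C) (n : nat) : C := a (S n).

Definition Cderive_coef (a : nat -> C) (n : nat) : C := (INR (S n) * a (S n))%C.

Lemma pow_n_C (z : C) n : @pow_n C_Ring z n = (z ^ n)%C.
Proof. induction n as [|n IH]; [reflexivity|]. simpl. now rewrite IH. Qed.

Lemma is_pseries_C_iff (a : nat -> C) (z l : C) :
  is_pseries_C a z l <-> is_series_C (fun n => (a n * z ^ n)%C) l.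
Proof.
assert (E : forall n, scal (@pow_n C_AbsRing z n) (a n) = (a n * z ^ n)%C).
{ intros n. change (@pow_n C_Ring z n * a n = a n * z ^ n)%C. rewrite pow_n_C. ring. }
split; apply @is_series_ext; intros n; [|symmetry]; apply E.
Qed.

Lemma is_pseries_C_unique (a : nat -> C) (z l l' : C) :
  is_pseries_C a z l -> is_pseries_C a z l' -> l = l'.
Proof.
apply (@filterlim_locally_unique nat C_AbsRing C_NormedModule eventually _).
Qed.

Lemma Csum_unique (a : nat -> C) (z l : C) : is_pseries_C a z l -> Csum a z = l.
Proof.
intros H. apply (@iota_unique C_AbsRing C_CompleteNormedModule); [|exact H].
intros l' Hl'. exact (is_pseries_C_unique _ _ _ _ Hl' H).
Qed.

Lemma Csum_correct a z : converges_on_disc a -> in_disc z -> is_pseries_C a z (Csum a z).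
Proof. intros H Hz. destruct (H z Hz) as [l Hl]. now rewrite (Csum_unique _ _ _ Hl). Qed.

Lemma Csum_0 a : Csum a 0%C = a 0%nat.
Proof. apply Csum_unique. exact (@is_pseries_0 C_AbsRing C_NormedModule a). Qed.

Lemma Csum_shift (a : nat -> C) (z l : C) : is_pseries_C a z l -> z <> 0%C ->
  is_pseries_C (Cshift a) z ((l - a 0%nat) / z)%C.
Proof.
intros H Hz.
replace ((l - a 0%nat) / z)%C with (/ z * (l - a 0%nat))%C by (field; auto).
apply (@is_pseries_decr_1 C_AbsRing C_NormedModule); [now apply Cinv_l | exact H].
Qed.

Lemma converges_on_disc_shift a : converges_on_disc a -> converges_on_disc (Cshift a).
Proof.
intros H z Hz. destruct (Ceq_dec z 0) as [->|Hz0].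
- exists (Cshift a 0%nat). exact (@is_pseries_0 C_AbsRing C_NormedModule _).
- destruct (H z Hz) as [l Hl]. eexists. now apply Csum_shift with (1 := Hl).
Qed.

Lemma Csum_decr a z : converges_on_disc a -> in_disc z ->
  Csum a z = (a 0%nat + z * Csum (Cshift a) z)%C.
Proof.
intros H Hz. destruct (Ceq_dec z 0) as [->|Hz0].
- rewrite Csum_0. ring.
- rewrite (Csum_unique (Cshift a) z _ (Csum_shift _ _ _ (Csum_correct a z H Hz) Hz0)).
  field. exact Hz0.
Qed.

Lemma converges_on_disc_minus a b : converges_on_disc a -> converges_on_disc b ->
  converges_on_disc (fun n => (a n - b n)%C).
Proof.
intros Ha Hb z Hz. destruct (Ha z Hz) as [l Hl], (Hb z Hz) as [m Hm].
exists (l - m)%C. exact (@is_pseries_minus C_AbsRing C_NormedModule _ _ _ _ _ Hl Hm).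
Qed.

Lemma Csum_minus a b z : converges_on_disc a -> converges_on_disc b -> in_disc z ->
  Csum (fun n => (a n - b n)%C) z = (Csum a z - Csum b z)%C.
Proof.
intros Ha Hb Hz. apply Csum_unique.
exact (@is_pseries_minus C_AbsRing C_NormedModule _ _ _ _ _
  (Csum_correct a z Ha Hz) (Csum_correct b z Hb Hz)).
Qed.

(** Convergence at a point of larger modulus bounds the terms, hence gives
    absolute convergence; the theory of real power series then applies to the
    moduli of the coefficients, including twice differentiated ones. *)
Lemma CV_radius_Cmod a r : converges_on_disc a -> 0 <= r < 1 ->
  Rbar_lt (Rabs r) (CV_radius (fun n => Cmod (a n))).
Proof.
intros H Hr. rewrite Rabs_pos_eq by lra.
set (s := (1 + r) / 2).
apply Rbar_lt_le_trans with s; [simpl; unfold s; lra|].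
apply CV_radius_bounded.
assert (Hs : in_disc s).
{ unfold in_disc. rewrite Cmod_R, Rabs_pos_eq; unfold s; lra. }
destruct (H s Hs) as [l Hl]. apply is_pseries_C_iff in Hl.
set (t := fun k => (a k * s ^ k)%C) in *.
destruct (@filterlim_bounded C_AbsRing C_NormedModule _ (ex_intro _ l Hl)) as [M HM].
assert (HM' : forall k, Cmod (@sum_n C_AbelianMonoid t k) <= M) by exact HM.
exists (2 * M). intros n.
assert (Ht : Cmod (t n) <= 2 * M).
{ destruct n as [|n].
  - specialize (HM' 0%nat). rewrite sum_O in HM'. pose proof (Cmod_ge_0 (t 0%nat)). lra.
  - pose proof (HM' (S n)) as H1. rewrite sum_Sn in H1. specialize (HM' n).
    set (S := @sum_n C_AbelianMonoid t n) in *.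
    change (Cmod (S + t (Datatypes.S n)) <= M) in H1.
    pose proof (Cmod_triangle (S + t (Datatypes.S n)) (- S)) as T.
    rewrite Cmod_opp in T.
    replace (S + t (Datatypes.S n) + - S)%C with (t (Datatypes.S n)) in T by ring. lra. }
rewrite Rabs_pos_eq.
2: { apply Rmult_le_pos. apply Cmod_ge_0. apply pow_le. unfold s; lra. }
apply Rle_trans with (2 := Ht). apply Req_le. unfold t.
now rewrite Cmod_mult, Cmod_pow, Cmod_R, (Rabs_pos_eq s) by (unfold s; lra).
Qed.

Lemma is_series_C_norm_le (a : nat -> C) (l : C) (b : nat -> R) (s : R) :
  is_series_C a l -> (forall n, Cmod (a n) <= b n) -> is_series b s -> Cmod l <= s.
Proof.
intros Hl Hb Hs.
assert (H1 : is_lim_seq (fun n => Cmod (@sum_n C_AbelianMonoid a n)) (Cmod l)).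
{ apply filterlim_comp with (1 := Hl).
  exact (@filterlim_norm C_AbsRing C_NormedModule l). }
apply (is_lim_seq_le _ (sum_n b) (Cmod l) s) with (2 := H1); [|exact Hs].
intros n. apply Rle_trans with (1 := @norm_sum_n_m C_AbsRing C_NormedModule _ 0 n).
apply sum_n_m_le. exact Hb.
Qed.

Lemma converges_on_disc_derive a : converges_on_disc a -> converges_on_disc (Cderive_coef a).
Proof.
intros H z Hz.
destruct (@ex_series_le C_AbsRing C_CompleteNormedModule
  (fun n => (Cderive_coef a n * z ^ n)%C)
  (fun n => Rabs (PS_derive (fun n => Cmod (a n)) n * Cmod z ^ n))) as [l Hl].
- intros n. change (Cmod (Cderive_coef a n * z ^ n)%C <=
    Rabs (PS_derive (fun n => Cmod (a n)) n * Cmod z ^ n)).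
  unfold Cderive_coef, PS_derive. rewrite !Cmod_mult, Cmod_pow, Cmod_R.
  rewrite !Rabs_mult, (Rabs_pos_eq (Cmod z ^ n)), (Rabs_pos_eq (Cmod (a (S n)))).
  apply Req_le; ring. apply Cmod_ge_0. apply pow_le, Cmod_ge_0.
- apply CV_disk_inside. rewrite CV_radius_derive. apply CV_radius_Cmod; [exact H|].
  split; [apply Cmod_ge_0 | exact Hz].
- exists l. now apply is_pseries_C_iff.
Qed.

(** With E_n the remainder for the exponent n, one has
    E_(n+1) = w E_n + n (w - z)^2 z^(n-1). *)
Lemma pow_second_difference (z w : C) (r : R) n :
  Cmod z <= r -> Cmod w <= r ->
  Cmod (w ^ S (S n) - z ^ S (S n) - (w - z) * (INR (S (S n)) * z ^ S n))%C
    <= INR (S n) * INR (S (S n)) * r ^ n * Cmod (w - z) ^ 2.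
Proof.
intros Hz Hw.
assert (Hr : 0 <= r) by (pose proof (Cmod_ge_0 z); lra).
assert (Hd : 0 <= Cmod (w - z) ^ 2) by apply pow2_ge_0.
induction n as [|n IH].
- replace (w ^ 2 - z ^ 2 - (w - z) * (INR 2 * z ^ 1))%C with ((w - z) ^ 2)%C.
  rewrite Cmod_pow. simpl INR. lra.
  simpl INR. rewrite RtoC_plus. ring.
- set (m := S n) in *.
  replace (w ^ S (S m) - z ^ S (S m) - (w - z) * (INR (S (S m)) * z ^ S m))%C
    with (w * (w ^ S m - z ^ S m - (w - z) * (INR (S m) * z ^ m))
          + INR (S m) * (z ^ m * (w - z) ^ 2))%C.
  2: { clearbody m. rewrite (S_INR (S m)), RtoC_plus, !Cpow_S. simpl (_ ^ 0)%C. ring. }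
  apply Rle_trans with (1 := Cmod_triangle _ _).
  rewrite !Cmod_mult, !Cmod_pow, Cmod_R, (Rabs_pos_eq _ (pos_INR _)).
  assert (Hzm : Cmod z ^ m <= r ^ m) by (apply pow_incr; split; [apply Cmod_ge_0 | lra]).
  assert (H1 : Cmod w * Cmod (w ^ S m - z ^ S m - (w - z) * (INR (S m) * z ^ m))%C <=
    r * (INR m * INR (S m) * r ^ n * Cmod (w - z) ^ 2)).
  { apply Rmult_le_compat; auto using Cmod_ge_0. }
  assert (H2 : INR (S m) * (Cmod z ^ m * Cmod (w - z) ^ 2) <=
    INR (S m) * (r ^ m * Cmod (w - z) ^ 2)).
  { apply Rmult_le_compat_l. apply pos_INR. now apply Rmult_le_compat_r. }
  apply Rle_trans with (1 := Rplus_le_compat _ _ _ _ H1 H2).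
  assert (H3 : 0 <= INR (S m) * (r ^ m * Cmod (w - z) ^ 2)).
  { apply Rmult_le_pos; [apply pos_INR|]. apply Rmult_le_pos; [now apply pow_le | exact Hd]. }
  assert (Em : r ^ m = r * r ^ n) by reflexivity.
  clearbody m. rewrite (S_INR (S m)), Em in *.
  pose proof (S_INR m) as Sm. set (k := INR (S m)) in *.
  replace (INR m) with (k - 1) by lra. nra.
Qed.

(** Termwise differentiation: summing the remainders of the monomials leaves a
    multiple of (w - z)^2, the factor being the sum of the twice differentiated
    series of moduli at a radius between |z| and 1. *)
Lemma is_derive_Csum a z : converges_on_disc a -> in_disc z ->
  is_derive_C (Csum a) z (Csum (Cderive_coef a) z).
Proof.
intros H Hz. set (r := (1 + Cmod z) / 2).
pose proof (Cmod_ge_0 z) as Hz0. unfold in_disc in Hz.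
assert (Hr : 0 <= r < 1) by (unfold r; lra).
set (A := PS_derive (PS_derive (fun n => Cmod (a n)))).
assert (HA : ex_series (fun n => A n * r ^ n)).
{ apply ex_series_Rabs, CV_disk_inside. unfold A. rewrite !CV_radius_derive.
  now apply CV_radius_Cmod. }
destruct HA as [s Hs].
apply is_derive_C_quadratic with (M := s) (d := (1 - Cmod z) / 2). lra.
intros w Hw.
assert (Hwr : Cmod w <= r).
{ pose proof (Cmod_triangle z (w - z)) as T. replace (z + (w - z))%C with w in T by ring.
  unfold r; lra. }
assert (Hwd : in_disc w) by (unfold in_disc; lra).
set (E := fun n => (a n * (w ^ n - z ^ n - (w - z) *
   match n with O => 0 | S m => INR n * z ^ m end))%C).
assert (HE : is_series_C E (Csum a w - Csum a z - (w - z) * Csum (Cderive_coef a) z)%C).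
{ pose proof (proj1 (is_pseries_C_iff _ _ _) (Csum_correct a w H Hwd)) as Sw.
  pose proof (proj1 (is_pseries_C_iff _ _ _) (Csum_correct a z H Hz)) as Sz.
  pose proof (proj1 (is_pseries_C_iff _ _ _)
    (Csum_correct _ z (converges_on_disc_derive a H) Hz)) as Sd.
  assert (Sd' : is_series_C (fun n => a n *
     match n with O => 0 | S m => INR n * z ^ m end)%C (Csum (Cderive_coef a) z)).
  { apply (@is_series_decr_1 C_AbsRing C_NormedModule).
    assert (E0 : (Csum (Cderive_coef a) z + - (a 0%nat * 0))%C = Csum (Cderive_coef a) z)
      by ring.
    change (is_series_C (fun n => a (S n) * (INR (S n) * z ^ n))%C
      (Csum (Cderive_coef a) z + - (a 0%nat * 0))%C).
    rewrite E0. apply is_series_ext with (2 := Sd). intros n. unfold Cderive_coef. ring_C. }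
  pose proof (@is_series_minus C_AbsRing C_NormedModule _ _ _ _
    (@is_series_minus C_AbsRing C_NormedModule _ _ _ _ Sw Sz)
    (@is_series_scal C_AbsRing C_NormedModule (w - z)%C _ _ Sd')) as T.
  apply is_series_ext with (2 := T). intros n.
  change ((a n * w ^ n + - (a n * z ^ n)) + - ((w - z) *
    (a n * match n with O => 0 | S m => INR n * z ^ m end)) = E n)%C.
  unfold E. ring_C. }
rewrite (Rmult_comm s).
apply is_series_C_norm_le with (1 := HE) 
  (b := fun n => match n with S (S m) => A m * r ^ m * Cmod (w - z) ^ 2 | _ => 0 end).
- intros n. unfold E.
  destruct n as [|[|n]].
  + replace (_ * _)%C with (RtoC 0) by (simpl; ring). rewrite Cmod_0; lra.
  + replace (_ * _)%C with (RtoC 0) by (simpl; ring). rewrite Cmod_0; lra.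
  + rewrite Cmod_mult. unfold A, PS_derive.
    pose proof (pow_second_difference z w r n ltac:(unfold r; lra) Hwr) as P.
    apply Rle_trans with (1 := Rmult_le_compat_l _ _ _ (Cmod_ge_0 _) P).
    apply Req_le; ring.
- apply is_series_decr_1, is_series_decr_1.
  replace (plus _ _) with (Cmod (w - z) ^ 2 * s) by (unfold plus, opp; simpl; ring).
  apply is_series_ext with (2 := @is_series_scal R_AbsRing R_NormedModule (Cmod (w - z) ^ 2) _ _ Hs).
  intros n. unfold scal; simpl; unfold mult; simpl. ring.
Qed.

Lemma smooth_on_disc_Csum n : forall a, converges_on_disc a -> smooth_on_disc n (Csum a).
Proof.
induction n as [|n IH]; intros a Ha; [exact I|].
exists (Csum (Cderive_coef a)). split.
- intros z Hz. now apply is_derive_Csum.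
- now apply IH, converges_on_disc_derive.
Qed.

(** * Mean values over circles and a Schwarz lemma *)

Definition polar (r t : R) : C := (r * cos t, r * sin t).

Lemma Cmod_polar r t : Cmod (polar r t) = Rabs r.
Proof.
unfold Cmod, polar; simpl fst; simpl snd.
replace ((r * cos t) ^ 2 + (r * sin t) ^ 2) with (Rsqr r).
apply sqrt_Rsqr_abs.
pose proof (sin2_cos2 t) as E. unfold Rsqr in *. nra.
Qed.

Lemma Cmod_le_Rmax (x y : R) : Cmod (x, y) <= 2 * Rmax (Rabs x) (Rabs y).
Proof.
apply Rle_trans with (1 := Cmod_2Rmax (x, y)). simpl.
apply Rmult_le_compat_r.
- apply Rle_trans with (2 := Rmax_l _ _). apply Rabs_pos.
- rewrite <- (sqrt_square 2) at 2 by lra. apply sqrt_le_1_alt. lra.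
Qed.

Lemma im_le_Cmod (c : C) : Rabs (Im c) <= Cmod c.
Proof. apply Rle_trans with (2 := Rmax_Cmod c). apply Rmax_r. Qed.

Lemma differentiable_C (h : C -> C) (z l : C) : is_derive_C h z l ->
  differentiable_pt_lim (fun x y => Re (h (x, y))) (Re z) (Im z) (Re l) (- Im l) /\
  differentiable_pt_lim (fun x y => Im (h (x, y))) (Re z) (Im z) (Im l) (Re l).
Proof.
intros H.
assert (K : forall eps : posreal, locally_2d (fun x y =>
  Cmod (h (x, y) - h z - ((x, y) - z) * l)%C <=
    eps * Rmax (Rabs (x - Re z)) (Rabs (y - Im z))) (Re z) (Im z)).
{ intros eps.
  destruct (proj1 (is_derive_C_iff _ _ _) H (pos_div_2 eps)) as [d Hd].
  exists (pos_div_2 d). intros x y Hx Hy. simpl in Hx, Hy.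
  assert (B : Cmod ((x, y) - z) <= 2 * Rmax (Rabs (x - Re z)) (Rabs (y - Im z)))
    by apply Cmod_le_Rmax.
  assert (B2 : Rmax (Rabs (x - Re z)) (Rabs (y - Im z)) < d / 2) by now apply Rmax_lub_lt.
  apply Rle_trans with (1 := Hd (x, y) ltac:(lra)). simpl.
  pose proof (cond_pos eps). nra. }
split; intros eps; destruct (K eps) as [d Hd]; exists d; intros x y Hx Hy;
  (apply Rle_trans with (2 := Hd x y Hx Hy)).
- apply Rle_trans with (2 := re_le_Cmod _). apply Req_le. f_equal.
  destruct z as [z1 z2], l as [l1 l2]; simpl. unfold Re, Im; simpl. ring.
- apply Rle_trans with (2 := im_le_Cmod _). apply Req_le. f_equal.
  destruct z as [z1 z2], l as [l1 l2]; simpl. unfold Re, Im; simpl. ring.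
Qed.

(** When [h'] is the derivative of h, this is the derivative of Re h(r e^(it))
    with respect to r. *)
Definition radial_derivative (h' : C -> C) (r t : R) : R :=
  Re (h' (polar r t) * polar 1 t)%C.

Lemma polar_in_disc r t : Rabs r < 1 -> in_disc (polar r t).
Proof. intros H. unfold in_disc. now rewrite Cmod_polar. Qed.

Lemma is_derive_radial (h h' : C -> C) (r t : R) :
  (forall z, in_disc z -> is_derive_C h z (h' z)) -> Rabs r < 1 ->
  is_derive (fun r => Re (h (polar r t))) r (radial_derivative h' r t).
Proof.
intros Hh Hr. apply is_derive_Reals.
destruct (differentiable_C _ _ _ (Hh _ (polar_in_disc r t Hr))) as [D _].
replace (radial_derivative h' r t) with
  (Re (h' (polar r t)) * cos t + - Im (h' (polar r t)) * sin t)
  by (unfold radial_derivative; rewrite re_mult; unfold polar at 4 6; simpl; ring).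
apply (derivable_pt_lim_comp_2d (fun x y => Re (h (x, y))) (fun r => r * cos t)
  (fun r => r * sin t) r).
- exact D.
- apply is_derive_Reals. auto_derive; trivial; ring.
- apply is_derive_Reals. auto_derive; trivial; ring.
Qed.

(** The Cauchy-Riemann equations in polar coordinates: the angular derivative of
    Im h is r times the radial derivative of Re h. *)
Lemma is_derive_angular (h h' : C -> C) (r t : R) :
  (forall z, in_disc z -> is_derive_C h z (h' z)) -> Rabs r < 1 ->
  is_derive (fun t => Im (h (polar r t))) t (r * radial_derivative h' r t).
Proof.
intros Hh Hr. apply is_derive_Reals.
destruct (differentiable_C _ _ _ (Hh _ (polar_in_disc r t Hr))) as [_ D].
replace (r * radial_derivative h' r t) with
  (Im (h' (polar r t)) * (- (r * sin t)) + Re (h' (polar r t)) * (r * cos t))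
  by (unfold radial_derivative; rewrite re_mult; unfold polar at 4 6; simpl; ring).
apply (derivable_pt_lim_comp_2d (fun x y => Im (h (x, y))) (fun t => r * cos t)
  (fun t => r * sin t) t).
- exact D.
- apply is_derive_Reals. auto_derive; trivial; ring.
- apply is_derive_Reals. auto_derive; trivial; ring.
Qed.

Lemma continuity_2d_polar (f : R -> R -> R) r t :
  continuity_2d_pt f (r * cos t) (r * sin t) ->
  continuity_2d_pt (fun r t => f (r * cos t) (r * sin t)) r t.
Proof.
intros H. apply continuity_2d_pt_filterlim.
apply (continuous_comp_2 (fun p : R * R => fst p * cos (snd p))
  (fun p => fst p * sin (snd p)) f (r, t)); simpl.
- apply (proj1 (continuity_2d_pt_filterlim (fun r t => r * cos t) r t)).
  apply continuity_2d_pt_mult. apply continuity_2d_pt_id1.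
  apply (continuity_1d_2d_pt_comp cos (fun _ t => t)).
  apply continuity_cos. apply continuity_2d_pt_id2.
- apply (proj1 (continuity_2d_pt_filterlim (fun r t => r * sin t) r t)).
  apply continuity_2d_pt_mult. apply continuity_2d_pt_id1.
  apply (continuity_1d_2d_pt_comp sin (fun _ t => t)).
  apply continuity_sin. apply continuity_2d_pt_id2.
- apply (proj1 (continuity_2d_pt_filterlim _ _ _)). exact H.
Qed.

Lemma continuity_2d_radial_derivative (h' h'' : C -> C) (r t : R) :
  (forall z, in_disc z -> is_derive_C h' z (h'' z)) -> Rabs r < 1 ->
  continuity_2d_pt (radial_derivative h') r t.
Proof.
intros Hh' Hr.
destruct (differentiable_C _ _ _ (Hh' _ (polar_in_disc r t Hr))) as [D1 D2].
assert (C1 : continuity_2d_pt (fun r t => Re (h' (polar r t))) r t).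
{ apply (continuity_2d_polar (fun x y => Re (h' (x, y)))).
  apply differentiable_continuity_pt. eexists; eexists; exact D1. }
assert (C2 : continuity_2d_pt (fun r t => Im (h' (polar r t))) r t).
{ apply (continuity_2d_polar (fun x y => Im (h' (x, y)))).
  apply differentiable_continuity_pt. eexists; eexists; exact D2. }
apply continuity_2d_pt_ext with
  (fun r t => Re (h' (polar r t)) * cos t - Im (h' (polar r t)) * sin t).
- intros x y. unfold radial_derivative. rewrite re_mult. unfold polar at 4 6; simpl; ring.
- apply continuity_2d_pt_minus; (apply continuity_2d_pt_mult; [assumption|]).
  + apply (continuity_1d_2d_pt_comp cos (fun _ t => t)).
    apply continuity_cos. apply continuity_2d_pt_id2.
  + apply (continuity_1d_2d_pt_comp sin (fun _ t => t)).
    apply continuity_sin. apply continuity_2d_pt_id2.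
Qed.

Lemma locally_Rabs_lt_1 r : Rabs r < 1 -> locally r (fun r => Rabs r < 1).
Proof.
intros Hr. assert (H : 0 < 1 - Rabs r) by lra.
exists (mkposreal _ H). intros y Hy.
change (Rabs (y - r) < 1 - Rabs r) in Hy.
pose proof (Rabs_triang r (y - r)) as T. rewrite (Rplus_minus r y) in T. lra.
Qed.

Lemma continuous_circle (h h' : C -> C) (r t : R) :
  (forall z, in_disc z -> is_derive_C h z (h' z)) -> Rabs r < 1 ->
  continuous (fun t => Re (h (polar r t))) t.
Proof.
intros Hh Hr.
destruct (differentiable_C _ _ _ (Hh _ (polar_in_disc r t Hr))) as [D _].
apply @ex_derive_continuous. eexists. apply is_derive_Reals.
apply (derivable_pt_lim_comp_2d (fun x y => Re (h (x, y))) (fun t => r * cos t)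
  (fun t => r * sin t) t _ _ (- (r * sin t)) (r * cos t) D).
- apply is_derive_Reals. auto_derive; trivial; ring.
- apply is_derive_Reals. auto_derive; trivial; ring.
Qed.

Lemma ex_RInt_circle (h h' : C -> C) (r : R) :
  (forall z, in_disc z -> is_derive_C h z (h' z)) -> Rabs r < 1 ->
  ex_RInt (fun t => Re (h (polar r t))) 0 (2 * PI).
Proof.
intros Hh Hr. apply @ex_RInt_continuous. intros t _. now apply continuous_circle with h'.
Qed.

Lemma is_derive_circle_integral (h h' h'' : C -> C) (r : R) :
  (forall z, in_disc z -> is_derive_C h z (h' z)) ->
  (forall z, in_disc z -> is_derive_C h' z (h'' z)) -> Rabs r < 1 ->
  is_derive (fun r => RInt (fun t => Re (h (polar r t))) 0 (2 * PI)) r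
    (RInt (radial_derivative h' r) 0 (2 * PI)).
Proof.
intros Hh Hh' Hr.
replace (RInt (radial_derivative h' r) 0 (2 * PI)) with
  (RInt (fun t => Derive (fun r => Re (h (polar r t))) r) 0 (2 * PI)).
2: { apply RInt_ext. intros t _. apply is_derive_unique. now apply is_derive_radial. }
apply is_derive_RInt_param.
- apply filter_imp with (2 := locally_Rabs_lt_1 r Hr). intros s Hs t _.
  exists (radial_derivative h' s t). now apply is_derive_radial.
- intros t _. apply continuity_2d_pt_ext_loc with (radial_derivative h'); [|
    now apply continuity_2d_radial_derivative with h''].
  destruct (locally_Rabs_lt_1 r Hr) as [d Hd]. exists d. intros u v Hu _.
  symmetry. apply is_derive_unique, is_derive_radial; [exact Hh|]. apply Hd. exact Hu.
- apply filter_imp with (2 := locally_Rabs_lt_1 r Hr).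
  intros s Hs. now apply ex_RInt_circle with h'.
Qed.

(** The integrand is, up to the factor r, the derivative of a 2 pi-periodic
    function of the angle. *)
Lemma RInt_radial_derivative (h h' h'' : C -> C) (r : R) :
  (forall z, in_disc z -> is_derive_C h z (h' z)) ->
  (forall z, in_disc z -> is_derive_C h' z (h'' z)) -> Rabs r < 1 -> r <> 0 ->
  RInt (radial_derivative h' r) 0 (2 * PI) = 0.
Proof.
intros Hh Hh' Hr H0.
assert (Cdr : forall t, continuous (radial_derivative h' r) t).
{ intros t. pose proof (continuity_2d_radial_derivative h' h'' r t Hh' Hr) as K.
  apply continuity_2d_pt_filterlim in K.
  apply (continuous_comp_2 (fun _ => r) (fun t => t) (radial_derivative h') t);
   [apply continuous_const | apply continuous_id | exact K]. }
assert (I : is_RInt (fun t => r * radial_derivative h' r t) 0 (2 * PI) 0).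
{ replace 0 with (minus (Im (h (polar r (2 * PI)))) (Im (h (polar r 0)))) at 2.
  - apply (is_RInt_derive (fun t => Im (h (polar r t)))).
    + intros t _. now apply is_derive_angular.
    + intros t _. apply (continuous_scal_r r (radial_derivative h' r)). apply Cdr.
  - unfold polar. rewrite cos_2PI, sin_2PI, cos_0, sin_0. unfold minus, plus, opp; simpl. ring. }
apply (is_RInt_unique (V := R_CompleteNormedModule)) in I.
apply Rmult_eq_reg_l with r; [|exact H0]. rewrite Rmult_0_r. apply eq_trans with (2 := I).
symmetry. apply (RInt_scal (V := R_CompleteNormedModule) (radial_derivative h' r)).
apply @ex_RInt_continuous. intros; apply Cdr.
Qed.

(** The circular means of Re h do not depend on the radius, because the integral
    of the radial derivative vanishes; at radius 0 the mean is the value at the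
    centre. *)
Lemma mean_value_property (h : C -> C) (r : R) : smooth_on_disc 2 h -> 0 < r < 1 ->
  RInt (fun t => Re (h (polar r t))) 0 (2 * PI) = 2 * PI * Re (h (RtoC 0)).
Proof.
intros [h' [Hh [h'' [Hh' _]]]] Hr.
set (J := fun r => RInt (fun t => Re (h (polar r t))) 0 (2 * PI)).
assert (HJ : forall x, 0 <= x <= r -> Rabs x < 1) by (intros; rewrite Rabs_pos_eq; lra).
destruct (MVT_gen J 0 r (fun _ => 0)) as [c [_ E]].
- rewrite Rmin_left, Rmax_right by lra. intros x Hx.
  rewrite <- (RInt_radial_derivative h h' h'' x Hh Hh'); [|apply HJ; lra|lra].
  apply is_derive_circle_integral with h''; [exact Hh | exact Hh' | apply HJ; lra].
- rewrite Rmin_left, Rmax_right by lra. intros x Hx.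
  apply continuity_pt_filterlim, @ex_derive_continuous.
  eexists. apply is_derive_circle_integral with (1 := Hh) (2 := Hh'). now apply HJ.
- change (J r = 2 * PI * Re (h (RtoC 0))).
  replace (J r) with (J 0) by lra. unfold J.
  rewrite (RInt_ext _ (fun _ => Re (h (RtoC 0)))).
  + rewrite RInt_const. unfold scal; simpl; unfold mult; simpl. ring.
  + intros t _. f_equal. f_equal. unfold polar. now rewrite !Rmult_0_l.
Qed.

(** The maximum principle at the centre: apply the mean value property to h
    multiplied by the conjugate of h(0), whose value at 0 is |h(0)|^2. *)
Lemma Cmod_center_le (h : C -> C) (r M : R) : smooth_on_disc 2 h -> 0 < r < 1 ->
  (forall z, Cmod z = r -> Cmod (h z) <= M) -> Cmod (h (RtoC 0)) <= M.
Proof.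
intros Hh Hr HM.
assert (HM0 : 0 <= M).
{ apply Rle_trans with (1 := Cmod_ge_0 (h (RtoC r))). apply (HM (RtoC r)). rewrite Cmod_R.
  now apply Rabs_pos_eq, Rlt_le. }
set (m := Cmod (h (RtoC 0))).
pose proof (Cmod_ge_0 (h (RtoC 0))) as Hm. fold m in Hm.
set (k := fun z => (Cconj (h (RtoC 0)) * h z)%C).
assert (Hk : smooth_on_disc 2 k).
{ apply (smooth_on_disc_mult 2 (fun _ => Cconj (h (RtoC 0))) h); [|exact Hh].
  apply smooth_on_disc_const. }
pose proof (mean_value_property k r Hk Hr) as E.
assert (E0 : Re (k (RtoC 0)) = m ^ 2).
{ unfold k. rewrite Cmult_comm, <- Cmod2_conj. fold m. apply re_RtoC. }
rewrite E0 in E.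
assert (I : RInt (fun t => Re (k (polar r t))) 0 (2 * PI) <= 2 * PI * (m * M)).
{ pose proof PI_RGT_0.
  replace (2 * PI * (m * M)) with (RInt (fun _ => m * M) 0 (2 * PI))
    by (rewrite RInt_const; unfold scal; simpl; unfold mult; simpl; ring).
  apply RInt_le; [lra | | apply ex_RInt_const |].
  - destruct Hk as [k' [Hk _]]. apply (ex_RInt_circle k k' r Hk). rewrite Rabs_pos_eq; lra.
  - intros t _. apply Rle_trans with (1 := Rle_abs _), Rle_trans with (1 := re_le_Cmod _).
    unfold k. rewrite Cmod_mult, Cmod_conj. fold m. apply Rmult_le_compat_l; [exact Hm|].
    apply HM. rewrite Cmod_polar. apply Rabs_pos_eq; lra. }
rewrite E in I. pose proof PI_RGT_0.
apply Rmult_le_reg_l in I; [|lra].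
destruct (Rle_lt_dec m M) as [|Hlt]; [assumption|].
simpl in I. nra.
Qed.

(** If p = 1 + z^n k has positive real part, the Cayley transform
    (p - 1) / (p + 1) = z^n h with h = k / (2 + z^n k) has modulus below 1. So
    |h| <= r^(-n) on the circle of radius r, hence also at 0, and
    h(0) = k(0) / 2; now let r tend to 1. *)
Lemma coefficient_le_2 (n : nat) (k : C -> C) : smooth_on_disc 2 k -> (0 < n)%nat ->
  (forall z, in_disc z -> 0 < Re (1 + z ^ n * k z)%C) -> Cmod (k (RtoC 0)) <= 2.
Proof.
intros Hk Hn Hp.
assert (Hpos : forall z, in_disc z -> 0 < Cmod (2 + z ^ n * k z)).
{ intros z Hz. apply Rlt_le_trans with (2 := re_le_Cmod _).
  apply Rlt_le_trans with (2 := Rle_abs _). specialize (Hp z Hz).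
  rewrite re_plus, re_RtoC in *. lra. }
set (h := fun z => (k z / (2 + z ^ n * k z))%C).
assert (Hh : smooth_on_disc 2 h).
{ apply (smooth_on_disc_div 2 k (fun z => (2 + z ^ n * k z)%C)); [exact Hk| |].
  - apply (smooth_on_disc_plus 2 (fun _ => RtoC 2) (fun z => (z ^ n * k z)%C)).
    apply smooth_on_disc_const. apply smooth_on_disc_mult; [apply smooth_on_disc_pow | exact Hk].
  - intros z Hz. apply Cmod_gt_0. now apply Hpos. }
assert (B : forall r, 0 < r < 1 -> r ^ n * Cmod (h (RtoC 0)) <= 1).
{ intros r Hr. assert (Hrn : 0 < r ^ n) by (apply pow_lt; lra).
  apply Rmult_le_reg_l with (/ r ^ n). now apply Rinv_0_lt_compat.
  rewrite <- Rmult_assoc, Rinv_l, Rmult_1_l, Rmult_1_r by lra.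
  apply Cmod_center_le with r; [exact Hh | exact Hr|].
  intros z Hz. assert (Hz1 : in_disc z) by (unfold in_disc; lra).
  specialize (Hpos z Hz1). specialize (Hp z Hz1).
  unfold h. rewrite Cmod_div by now apply Cmod_gt_0.
  apply Rmult_le_reg_l with (r ^ n * Cmod (2 + z ^ n * k z)). now apply Rmult_lt_0_compat.
  replace (r ^ n * Cmod (2 + z ^ n * k z) * (Cmod (k z) / Cmod (2 + z ^ n * k z)))
    with (r ^ n * Cmod (k z)) by (field; lra).
  replace (r ^ n * Cmod (2 + z ^ n * k z) * / r ^ n)
    with (Cmod (2 + z ^ n * k z)) by (field; lra).
  rewrite <- Hz at 1. rewrite <- Cmod_pow, <- Cmod_mult.
  set (q := (z ^ n * k z)%C) in *.
  apply Rsqr_incr_0; auto using Cmod_ge_0.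
  rewrite !Rsqr_pow2, !Cmod2_alt. rewrite re_plus, re_RtoC in *.
  destruct q as [q1 q2]; unfold Re, Im in *; simpl in *. nra. }
assert (E : (k (RtoC 0)) = (2 * h (RtoC 0))%C).
{ unfold h. destruct n; [lia|]. rewrite Cpow_S. field. }
rewrite E, Cmod_mult, Cmod_R, Rabs_pos_eq by lra.
cut (Cmod (h (RtoC 0)) <= 1). lra.
set (m := Cmod (h (RtoC 0))) in *.
destruct (Rle_lt_dec m 1) as [|Hm]; [assumption|exfalso].
assert (Bernoulli : forall e j, 0 <= e <= 1 -> 1 - INR j * e <= (1 - e) ^ j).
{ intros e j He. induction j as [|j IH]; [simpl; lra|].
  rewrite S_INR. simpl. pose proof (pos_INR j).
  assert (0 <= INR j * e * e) by (repeat apply Rmult_le_pos; lra). nra. }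
assert (Hn1 : 1 <= INR n) by (apply (le_INR 1); lia).
(* With this e, Bernoulli gives (1 - e)^n m >= (m + 1) / 2 > 1. *)
set (e := (m - 1) / (2 * INR n * m)).
assert (Enm : INR n * e * m = (m - 1) / 2) by (unfold e; field; lra).
assert (He : 0 < e) by (apply Rdiv_lt_0_compat; [lra | apply Rmult_lt_0_compat; lra]).
assert (He1 : e < 1) by (apply Rnot_le_lt; intros K; assert (1 <= INR n * e) by nra; nra).
pose proof (Bernoulli e n ltac:(lra)) as K.
pose proof (B (1 - e) ltac:(lra)) as K2. nra.
Qed.

(** * Coefficients of close-to-convex functions *)

Lemma in_disc_opp z : in_disc z -> in_disc (- z)%C.
Proof. unfold in_disc. now rewrite Cmod_opp. Qed.

Lemma class_A_converges f a : class_A f a -> converges_on_disc a.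
Proof. intros [_ [_ [_ H]]] z Hz. exists (f z). now apply H. Qed.

Lemma class_A_Csum f a z : class_A f a -> in_disc z -> f z = Csum a z.
Proof. intros [_ [_ [_ H]]] Hz. symmetry. now apply Csum_unique, H. Qed.

Lemma class_A_derive f a z : class_A f a -> in_disc z ->
  C_derive f z = Csum (Cderive_coef a) z.
Proof.
intros Hf Hz. apply is_C_derive_unique.
apply is_derive_ext_loc with (Csum a).
- apply filter_imp with (2 := in_disc_open z Hz). intros w Hw.
  symmetry. exact (class_A_Csum f a w Hf Hw).
- apply is_derive_Csum; [exact (class_A_converges f a Hf) | exact Hz].
Qed.

(** The function p = F/G equals 1 + c_1 z + c_2 z^2 + ... with c_1 = F_1 - G_1.
    Keeping the quotient, rather than the Taylor series of p, spares the
    convergence of that series on the whole disc. *)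
Lemma caratheodory_first_coefficient (F G : nat -> C) :
  converges_on_disc F -> converges_on_disc G -> F 0%nat = 1%C -> G 0%nat = 1%C ->
  (forall z, in_disc z -> Csum G z <> 0%C) ->
  (forall z, in_disc z -> 0 < Re (Csum F z / Csum G z)%C) ->
  Cmod (F 1%nat - G 1%nat)%C <= 2.
Proof.
intros HF HG F0 G0 Gnz Hp.
set (D := fun n => (F n - G n)%C).
assert (HD : converges_on_disc D) by now apply converges_on_disc_minus.
pose proof (converges_on_disc_shift D HD) as HD1.
set (k := fun z => (Csum (Cshift D) z / Csum G z)%C).
replace (F 1%nat - G 1%nat)%C with (k (RtoC 0)).
2: { unfold k. rewrite !Csum_0, G0. unfold Cshift, D. field. }
apply (coefficient_le_2 1); [|lia|].
- apply smooth_on_disc_div; auto using smooth_on_disc_Csum.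
- intros z Hz. replace (1 + z ^ 1 * k z)%C with (Csum F z / Csum G z)%C; [now apply Hp|].
  pose proof (Csum_minus F G z HF HG Hz) as E. fold D in E.
  rewrite (Csum_decr D z HD Hz) in E.
  replace (Csum F z) with (Csum G z + z * Csum (Cshift D) z)%C.
  + unfold k. field. now apply Gnz.
  + replace (Csum F z) with (Csum G z + (Csum F z - Csum G z))%C by ring.
    rewrite <- E. unfold D. rewrite F0, G0. ring.
Qed.

(** Here c_2 = F_2 - G_2 - G_1 c_1. The even part (p(z) + p(-z)) / 2 has positive
    real part and no term in z, so it is 1 + z^2 k with k(0) = c_2. *)
Lemma caratheodory_second_coefficient (F G : nat -> C) :
  converges_on_disc F -> converges_on_disc G -> F 0%nat = 1%C -> G 0%nat = 1%C ->
  (forall z, in_disc z -> Csum G z <> 0%C) ->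
  (forall z, in_disc z -> 0 < Re (Csum F z / Csum G z)%C) ->
  Cmod (F 2%nat - G 2%nat - G 1%nat * (F 1%nat - G 1%nat))%C <= 2.
Proof.
intros HF HG F0 G0 Gnz Hp.
set (D := fun n => (F n - G n)%C).
assert (HD : converges_on_disc D) by now apply converges_on_disc_minus.
pose proof (converges_on_disc_shift D HD) as HD1.
pose proof (converges_on_disc_shift _ HD1) as HD2.
pose proof (converges_on_disc_shift G HG) as HG1.
set (d := D 1%nat).
set (K := Csum (Cshift (Cshift D))). set (L := Csum (Cshift G)).
assert (EG : forall z, in_disc z -> Csum G z = (1 + z * L z)%C).
{ intros z Hz. rewrite (Csum_decr G z HG Hz), G0. reflexivity. }
assert (EF : forall z, in_disc z -> Csum F z = (Csum G z + z * (d + z * K z))%C).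
{ intros z Hz. pose proof (Csum_minus F G z HF HG Hz) as E. fold D in E.
  rewrite (Csum_decr D z HD Hz), (Csum_decr _ z HD1 Hz) in E. fold K in E.
  change (Cshift D 0%nat) with d in E.
  replace (Csum F z) with (Csum G z + (Csum F z - Csum G z))%C by ring.
  rewrite <- E. unfold D. rewrite F0, G0. ring. }
(* With G = 1 + z L and F = G + z (d + z K), the numerator of p(z) + p(-z) - 2
   over the common denominator is z^2 N. *)
set (N := fun z => (K z + K (- z) - d * (L z + L (- z))
   - z * (K z * L (- z) - K (- z) * L z))%C).
set (k := fun z => (N z / (2 * (Csum G z * Csum G (- z))))%C).
replace (F 2%nat - G 2%nat - G 1%nat * (F 1%nat - G 1%nat))%C with (k (RtoC 0)).
2: { unfold k, N. replace (- 0)%C with (RtoC 0) by ring. unfold K, L.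
  rewrite !Csum_0, G0. unfold Cshift, d, D. field. }
assert (Gnz2 : forall z, in_disc z -> (2 * (Csum G z * Csum G (- z)))%C <> 0%C).
{ intros z Hz. apply Cmult_neq_0.
  - intros E. apply (f_equal fst) in E. simpl in E. lra.
  - apply Cmult_neq_0; apply Gnz; [exact Hz | now apply in_disc_opp]. }
assert (SK : smooth_on_disc 2 K) by now apply smooth_on_disc_Csum.
assert (SL : smooth_on_disc 2 L) by now apply smooth_on_disc_Csum.
assert (SG : smooth_on_disc 2 (Csum G)) by now apply smooth_on_disc_Csum.
apply (coefficient_le_2 2); [|lia|].
- apply smooth_on_disc_div; [| |exact Gnz2].
  + unfold N. repeat first [apply smooth_on_disc_minus | apply smooth_on_disc_plus
      | apply smooth_on_disc_mult | apply smooth_on_disc_const | apply smooth_on_disc_id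
      | assumption | apply (smooth_on_disc_reflect 2 K) | apply (smooth_on_disc_reflect 2 L)].
  + apply smooth_on_disc_mult; [apply smooth_on_disc_const|].
    apply smooth_on_disc_mult; [exact SG | now apply (smooth_on_disc_reflect 2 (Csum G))].
- intros z Hz. pose proof (in_disc_opp z Hz) as Hz'.
  replace (1 + z ^ 2 * k z)%C with
    ((Csum F z / Csum G z + Csum F (- z) / Csum G (- z)) * (/ 2)%R)%C.
  + rewrite re_scal_r, re_plus. pose proof (Hp z Hz). pose proof (Hp _ Hz'). lra.
  + pose proof (Gnz z Hz) as N1. pose proof (Gnz _ Hz') as N2.
    rewrite RtoC_inv by lra. unfold k, N. rewrite (EF z Hz), (EF _ Hz').
    rewrite (EG z Hz), (EG _ Hz') in *. field. auto.
Qed.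

(** Comparing coefficients in z f' = g p gives 2 a_2 = b_2 + c_1 and
    3 a_3 = b_3 + b_2 c_1 + c_2. *)
Lemma close_to_convex_coefficients f a g b : class_A g b -> close_to_convex_wrt f a g ->
  Cmod (2 * a 2%nat - b 2%nat)%C <= 2 /\
  Cmod (3 * a 3%nat - b 3%nat - b 2%nat * (2 * a 2%nat - b 2%nat))%C <= 2.
Proof.
intros Hg [Hf Hpos].
pose proof (class_A_converges f a Hf) as Ca. pose proof (class_A_converges g b Hg) as Cb.
pose proof (converges_on_disc_derive a Ca) as CF.
pose proof (converges_on_disc_shift b Cb) as CG.
assert (a1 := proj1 (proj2 (proj2 Hf))).
assert (b0 := proj1 (proj2 Hg)). assert (b1 := proj1 (proj2 (proj2 Hg))).
assert (F0 : Cderive_coef a 0%nat = 1%C) by (unfold Cderive_coef; rewrite a1; simpl; ring).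
assert (G0 : Cshift b 0%nat = 1%C) by exact b1.
assert (Eg : forall z, in_disc z -> g z = (z * Csum (Cshift b) z)%C).
{ intros z Hz. rewrite (class_A_Csum g b z Hg Hz), (Csum_decr b z Cb Hz), b0. ring. }
assert (Gnz : forall z, in_disc z -> Csum (Cshift b) z <> 0%C).
{ intros z Hz. destruct (Ceq_dec z 0) as [->|Hz0].
  - rewrite Csum_0, G0. intros E. apply (f_equal fst) in E. simpl in E. lra.
  - intros E. specialize (Hpos z Hz Hz0). rewrite (Eg z Hz), E, Cmult_0_r in Hpos.
    (* A zero of g would make the quotient 0, which is not positive. *)
    unfold Cdiv in Hpos.
    replace (/ 0)%C with (RtoC 0) in Hpos.
    rewrite Cmult_0_r in Hpos. simpl in Hpos. lra.
    unfold Cinv, RtoC; simpl. unfold Rdiv. now rewrite Ropp_0, !Rmult_0_l. }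
assert (Hp : forall z, in_disc z -> 0 < Re (Csum (Cderive_coef a) z / Csum (Cshift b) z)%C).
{ intros z Hz. destruct (Ceq_dec z 0) as [->|Hz0].
  - rewrite !Csum_0, F0, G0. replace (1 / 1)%C with (RtoC 1) by field. simpl. lra.
  - specialize (Hpos z Hz Hz0). rewrite (class_A_derive f a z Hf Hz), (Eg z Hz) in Hpos.
    replace (Csum (Cderive_coef a) z / Csum (Cshift b) z)%C with
     (z * Csum (Cderive_coef a) z / (z * Csum (Cshift b) z))%C; [exact Hpos|].
    field. auto. }
assert (E2 : (Cderive_coef a 1%nat = 2 * a 2%nat)%C).
{ unfold Cderive_coef. simpl INR. now replace (1 + 1) with 2 by ring. }
assert (E3 : (Cderive_coef a 2%nat = 3 * a 3%nat)%C).
{ unfold Cderive_coef. simpl INR. now replace (1 + 1 + 1) with 3 by ring. }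
pose proof (caratheodory_first_coefficient _ _ CF CG F0 G0 Gnz Hp) as K1.
pose proof (caratheodory_second_coefficient _ _ CF CG F0 G0 Gnz Hp) as K2.
rewrite E2, ?E3 in *. now split.
Qed.

Lemma close_to_convex_moduli f a g b : class_A g b -> close_to_convex_wrt f a g ->
  2 * Cmod (a 2%nat) <= Cmod (b 2%nat) + 2 /\
  3 * Cmod (a 3%nat) <= Cmod (b 3%nat) + 2 * Cmod (b 2%nat) + 2.
Proof.
intros Hg Hf. destruct (close_to_convex_coefficients f a g b Hg Hf) as [K1 K2].
set (c1 := (2 * a 2%nat - b 2%nat)%C) in *.
set (c2 := (3 * a 3%nat - b 3%nat - b 2%nat * c1)%C) in *.
assert (E : forall (x : R) (z : C), 0 <= x -> x * Cmod z = Cmod (x * z)%C).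
{ intros x z Hx. now rewrite Cmod_mult, Cmod_R, Rabs_pos_eq. }
rewrite !E by lra. split.
- replace (2 * a 2%nat)%C with (b 2%nat + c1)%C by (unfold c1; ring).
  apply Rle_trans with (1 := Cmod_triangle _ _). lra.
- replace (3 * a 3%nat)%C with (b 3%nat + b 2%nat * c1 + c2)%C by (unfold c2; ring).
  apply Rle_trans with (1 := Cmod_triangle _ _).
  apply Rplus_le_compat; [|exact K2].
  apply Rle_trans with (1 := Cmod_triangle _ _). rewrite Cmod_mult, <- E by lra.
  pose proof (Cmod_ge_0 (b 2%nat)). nra.
Qed.

(** * The upper bound for the third determinant *)

Lemma Re_det_T_3_1_le a : a 1%nat = RtoC 1 ->
  Re (det_T 3 1 a) <=
    1 + 2 * Cmod (a 2%nat) ^ 2 * (Cmod (a 3%nat) - 1) - Cmod (a 3%nat) ^ 2.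
Proof.
intros a1. rewrite (det_T_3_1 a a1), re_RtoC.
assert (K : Re (a 2%nat ^ 2 * Cconj (a 3%nat))%C <= Cmod (a 2%nat) ^ 2 * Cmod (a 3%nat)).
{ apply Rle_trans with (1 := Rle_abs _), Rle_trans with (1 := re_le_Cmod _).
  rewrite Cmod_mult, Cmod_pow, Cmod_conj. lra. }
lra.
Qed.

(** The two factors are what the estimate needs: with S = (y + 2x + 2) / 3 and
    A = (1 + x/2)^2 they are 3 (S - 1) and 12 (A - S). *)
Lemma standing_ineq_factor x y :
  standing_ineq x y <-> 0 <= (2 * x + y - 1) * (3 * x ^ 2 + 4 * x + 4 - 4 * y).
Proof.
unfold standing_ineq.
now replace (6 * x ^ 3 - 4 * x * (y - 1) - 4 * (y - 1) ^ 2 + x ^ 2 * (3 * y + 5))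
  with ((2 * x + y - 1) * (3 * x ^ 2 + 4 * x + 4 - 4 * y)) by ring.
Qed.

(** For v <= 1 the left side is at most 1. For v > 1 it increases with u, and with
    u^2 = A it increases with v up to v = A; as v <= S <= A, it is at most its
    value at u^2 = A and v = S, which is [Phi x y / 18]. *)
Lemma det_majorant_le x y u v : 0 <= x -> 0 <= u -> 0 <= v -> standing_ineq x y ->
  2 * u <= x + 2 -> 3 * v <= y + 2 * x + 2 ->
  1 + 2 * u ^ 2 * (v - 1) - v ^ 2 <= Rmax 1 (Phi x y / 18).
Proof.
intros Hx Hu Hv Hs Hux Hvy. apply standing_ineq_factor in Hs.
destruct (Rle_lt_dec v 1) as [Hv1|Hv1].
{ apply Rle_trans with (2 := Rmax_l _ _). pose proof (pow2_ge_0 u). nra. }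
apply Rle_trans with (2 := Rmax_r _ _).
set (A := (1 + x / 2) ^ 2). set (S := (y + 2 * x + 2) / 3).
assert (HS : v <= S <= A).
{ unfold S, A. split; [lra|].
  assert (0 < 2 * x + y - 1) by lra.
  assert (0 <= 3 * x ^ 2 + 4 * x + 4 - 4 * y) by nra. nra. }
assert (HA : u ^ 2 <= A) by (unfold A; apply pow_incr; lra).
replace (Phi x y / 18) with (1 + 2 * A * (S - 1) - S ^ 2)
  by (unfold A, S, Phi; field).
apply Rle_trans with (1 + 2 * A * (v - 1) - v ^ 2); nra.
Qed.

Lemma hermitian_toeplitz_bounds f a g b : admissible f a g b ->
    (1 - (1 + Cmod (b 2%nat) / 2) ^ 2 <= Re (det_T 2 1 a) <= 1) /\
    (Phi (Cmod (b 2%nat)) (Cmod (b 3%nat)) - 18 <= 0 ->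
       Re (det_T 3 1 a) <= 1) /\
    (Phi (Cmod (b 2%nat)) (Cmod (b 3%nat)) - 18 > 0 ->
       Re (det_T 3 1 a) <= 1 / 18 * Phi (Cmod (b 2%nat)) (Cmod (b 3%nat))).
Proof.
intros [[Hg _] [Hs Hf]].
assert (a1 : a 1%nat = RtoC 1) by apply Hf.
destruct (close_to_convex_moduli f a g b Hg Hf) as [B2 B3].
pose proof (Cmod_ge_0 (a 2%nat)) as P2. pose proof (Cmod_ge_0 (a 3%nat)) as P3.
pose proof (Cmod_ge_0 (b 2%nat)) as Q2.
pose proof (det_majorant_le _ _ _ _ Q2 P2 P3 Hs B2 B3) as M.
pose proof (Re_det_T_3_1_le a a1) as D.
split; [|split].
- rewrite (det_T_2_1 a a1), re_RtoC. split; [|nra].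
  apply Rplus_le_compat_l, Ropp_le_contravar, pow_incr. lra.
- intros H. rewrite Rmax_left in M by lra. lra.
- intros H. rewrite Rmax_right in M by lra. lra.
Qed.

(** * Extremal functions *)

Lemma one_minus_neq_0 w : in_disc w -> (1 - w)%C <> 0%C.
Proof.
intros H E. assert (K : w = 1%C) by (replace w with (1 - (1 - w))%C by ring; rewrite E; ring).
unfold in_disc in H. rewrite K, Cmod_1 in H. lra.
Qed.

Lemma in_disc_mult z w : in_disc z -> in_disc w -> in_disc (z * w)%C.
Proof.
unfold in_disc. rewrite Cmod_mult. pose proof (Cmod_ge_0 z). pose proof (Cmod_ge_0 w). nra.
Qed.

Lemma Re_half_plane_map w : in_disc w -> 0 < Re ((1 + w) / (1 - w))%C.
Proof.
intros Hw.
assert (H : Re w ^ 2 + Im w ^ 2 < 1).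
{ rewrite <- Cmod2_alt. unfold in_disc in Hw. pose proof (Cmod_ge_0 w). nra. }
destruct w as [x y]. unfold Re, Im in *; simpl in *.
assert (HD : 0 < (1 - x) * (1 - x) + y * y) by nra.
match goal with |- 0 < ?e =>
  replace e with ((1 - (x * x + y * y)) / ((1 - x) * (1 - x) + y * y)) end.
- apply Rdiv_lt_0_compat; lra.
- field. repeat split; nra.
Qed.

Lemma converges_on_disc_bounded (a : nat -> C) :
  (forall n, Cmod (a n) <= 1) -> converges_on_disc a.
Proof.
intros H z Hz.
destruct (@ex_series_le C_AbsRing C_CompleteNormedModule (fun n => (a n * z ^ n)%C)
  (fun n => Cmod z ^ n)) as [l Hl].
- intros n. change (Cmod (a n * z ^ n)%C <= Cmod z ^ n).
  rewrite Cmod_mult, Cmod_pow. specialize (H n).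
  pose proof (pow_le _ n (Cmod_ge_0 z)). nra.
- eexists. apply is_series_geom. rewrite Rabs_pos_eq; [exact Hz | apply Cmod_ge_0].
- exists l. now apply is_pseries_C_iff.
Qed.

Lemma Csum_ext a b z : (forall n, a n = b n) -> converges_on_disc a -> in_disc z ->
  Csum a z = Csum b z.
Proof.
intros E H Hz. symmetry. apply Csum_unique.
apply is_pseries_ext with (1 := E). now apply Csum_correct.
Qed.

(** The functional equation s = a_0 + z s replaces the summation of a geometric
    series; the other extremal series are summed in the same way. *)
Lemma Csum_constant a z : (forall n, Cmod (a n) <= 1) -> in_disc z ->
  (forall n, a (S n) = a n) -> Csum a z = (a 0%nat / (1 - z))%C.
Proof.
intros Hb Hz Hp. pose proof (converges_on_disc_bounded a Hb) as H.
pose proof (one_minus_neq_0 z Hz) as Hz1.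
pose proof (Csum_decr a z H Hz) as E.
rewrite (Csum_ext (Cshift a) a z Hp (converges_on_disc_shift a H) Hz) in E.
replace (a 0%nat) with (Csum a z - z * Csum a z)%C by (rewrite E at 1; ring).
field. exact Hz1.
Qed.

Definition koebe (z : C) : C := (z / ((1 - z) * (1 - z)))%C.
Definition koebe_coef (n : nat) : C := INR n.

(** The odd square root transform of the Koebe function: its square is
    [koebe (z * z)]. *)
Definition odd_koebe (z : C) : C := (z / (1 - z * z))%C.
Definition odd_koebe_coef (n : nat) : C := if Nat.odd n then 1%C else 0%C.

Definition id_coef (n : nat) : C := if (n =? 1)%nat then 1%C else 0%C.

Lemma is_pseries_koebe z : in_disc z -> is_pseries_C koebe_coef z (koebe z).
Proof.
intros Hz. set (u := fun _ : nat => RtoC 1).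
assert (Hu : forall n, Cmod (u n) <= 1) by (intros; unfold u; rewrite Cmod_1; lra).
pose proof (converges_on_disc_bounded u Hu) as Cu.
pose proof (converges_on_disc_derive u Cu) as Cd.
pose proof (one_minus_neq_0 z Hz) as Hz1.
assert (Su : Csum u z = (1 / (1 - z))%C) by now apply Csum_constant.
(* The coefficients n + 1 satisfy s = 1 + z (s + 1 / (1 - z)). *)
assert (Sd : Csum (Cderive_coef u) z = (1 / ((1 - z) * (1 - z)))%C).
{ pose proof (Csum_decr _ z Cd Hz) as E.
  pose proof (converges_on_disc_shift _ Cd) as Cd1.
  pose proof (Csum_minus _ _ z Cd1 Cd Hz) as E1.
  rewrite (Csum_ext _ u z) in E1; [|
    intros n; unfold Cshift, Cderive_coef, u; rewrite (S_INR (S n)), RtoC_plus; ring |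
    now apply converges_on_disc_minus | exact Hz].
  replace (Csum (Cshift (Cderive_coef u)) z) with (Csum u z + Csum (Cderive_coef u) z)%C in E
    by (rewrite E1; ring).
  rewrite Su in E. unfold Cderive_coef at 2 in E. unfold u at 2 in E. simpl INR in E.
  set (s := Csum (Cderive_coef u) z) in *.
  replace s with ((s - z * s) / (1 - z))%C by (field; exact Hz1).
  rewrite E at 1. field. exact Hz1. }
replace (koebe z) with (Csum (Cderive_coef u) z - Csum u z)%C.
2: { rewrite Su, Sd. unfold koebe. field. exact Hz1. }
apply is_pseries_ext with (fun n => (Cderive_coef u n - u n)%C).
- intros n. unfold Cderive_coef, u, koebe_coef. rewrite S_INR, RtoC_plus. ring_C.
- exact (@is_pseries_minus C_AbsRing C_NormedModule _ _ _ _ _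
    (Csum_correct _ z Cd Hz) (Csum_correct _ z Cu Hz)).
Qed.

Lemma is_derive_koebe z : in_disc z ->
  is_derive_C koebe z ((1 + z) / ((1 - z) * (1 - z) * (1 - z)))%C.
Proof.
intros Hz. pose proof (one_minus_neq_0 z Hz) as Hz1.
assert (D1 : is_derive_C (fun w => (1 - w)%C) z (0 - 1)%C).
{ apply @is_derive_minus; [apply @is_derive_const | apply is_derive_C_id]. }
pose proof (is_derive_C_mult _ _ _ _ _ D1 D1) as D2.
pose proof (is_derive_C_recip _ _ _ D2 (Cmult_neq_0 _ _ Hz1 Hz1)) as D3.
pose proof (is_derive_C_mult _ _ _ _ _ (is_derive_C_id z) D3) as D4.
match type of D4 with @is_derive _ _ _ _ ?l =>
  replace ((1 + z) / ((1 - z) * (1 - z) * (1 - z)))%C with l end.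
- exact D4.
- field. exact Hz1.
Qed.

Lemma starlike_koebe : starlike koebe koebe_coef.
Proof.
split; [|split].
- split; [|split; [reflexivity|split; [reflexivity|exact is_pseries_koebe]]].
  intros z Hz. eexists. now apply is_derive_koebe.
- intros z w Hz Hw E. unfold koebe in E.
  pose proof (one_minus_neq_0 z Hz) as Hz1. pose proof (one_minus_neq_0 w Hw) as Hw1.
  pose proof (one_minus_neq_0 _ (in_disc_mult z w Hz Hw)) as Hzw.
  assert (K : ((z - w) * (1 - z * w) = 0)%C).
  { replace ((z - w) * (1 - z * w))%C with
     ((z / ((1 - z) * (1 - z)) - w / ((1 - w) * (1 - w))) * ((1 - z) * (1 - z) * ((1 - w) * (1 - w))))%C
     by (field; auto).
    rewrite E. ring. }
  replace z with ((z - w) * (1 - z * w) / (1 - z * w) + w)%C by (field; exact Hzw).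
  rewrite K. field. exact Hzw.
- intros z Hz Hz0. rewrite (is_C_derive_unique _ _ _ (is_derive_koebe z Hz)).
  pose proof (one_minus_neq_0 z Hz) as Hz1.
  unfold koebe. replace (_ / _)%C with ((1 + z) / (1 - z))%C by (field; auto).
  now apply Re_half_plane_map.
Qed.

Lemma is_pseries_odd_koebe z : in_disc z -> is_pseries_C odd_koebe_coef z (odd_koebe z).
Proof.
intros Hz.
assert (C0 : converges_on_disc odd_koebe_coef).
{ apply converges_on_disc_bounded. intros n. unfold odd_koebe_coef.
  destruct (Nat.odd n); rewrite ?Cmod_1, ?Cmod_0; lra. }
pose proof (converges_on_disc_shift _ C0) as C1.
pose proof (one_minus_neq_0 _ (in_disc_mult z z Hz Hz)) as Hz1.
pose proof (Csum_decr _ z C0 Hz) as E. rewrite (Csum_decr _ z C1 Hz) in E.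
rewrite (Csum_ext (Cshift (Cshift odd_koebe_coef)) odd_koebe_coef z) in E;
  [|intros n; reflexivity | now apply converges_on_disc_shift | exact Hz].
replace (odd_koebe z) with (Csum odd_koebe_coef z); [now apply Csum_correct|].
set (s := Csum odd_koebe_coef z) in *.
change (odd_koebe_coef 0%nat) with (RtoC 0) in E.
change (Cshift odd_koebe_coef 0%nat) with (RtoC 1) in E.
replace s with ((s - z * z * s) / (1 - z * z))%C by (field; exact Hz1).
rewrite E at 1. unfold odd_koebe. field. exact Hz1.
Qed.

Lemma is_derive_odd_koebe z : in_disc z ->
  is_derive_C odd_koebe z ((1 + z * z) / ((1 - z * z) * (1 - z * z)))%C.
Proof.
intros Hz. pose proof (one_minus_neq_0 _ (in_disc_mult z z Hz Hz)) as Hz1.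
assert (D1 : is_derive_C (fun w => (1 - w * w)%C) z (0 - (1 * z + z * 1))%C).
{ apply @is_derive_minus; [apply @is_derive_const |].
  apply (is_derive_C_mult (fun w => w) (fun w => w)); apply is_derive_C_id. }
pose proof (is_derive_C_recip _ _ _ D1 Hz1) as D3.
pose proof (is_derive_C_mult _ _ _ _ _ (is_derive_C_id z) D3) as D4.
match type of D4 with @is_derive _ _ _ _ ?l =>
  replace ((1 + z * z) / ((1 - z * z) * (1 - z * z)))%C with l end.
- exact D4.
- field. exact Hz1.
Qed.

Lemma starlike_odd_koebe : starlike odd_koebe odd_koebe_coef.
Proof.
split; [|split].
- split; [|split; [reflexivity|split; [reflexivity|exact is_pseries_odd_koebe]]].
  intros z Hz. eexists. now apply is_derive_odd_koebe.
- intros z w Hz Hw E. unfold odd_koebe in E.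
  pose proof (one_minus_neq_0 _ (in_disc_mult z z Hz Hz)) as Hz1.
  pose proof (one_minus_neq_0 _ (in_disc_mult w w Hw Hw)) as Hw1.
  pose proof (one_minus_neq_0 _ (in_disc_mult _ _ (in_disc_opp _ Hz) Hw)) as Hzw.
  assert (K : ((z - w) * (1 - (- z) * w) = 0)%C).
  { replace ((z - w) * (1 - (- z) * w))%C with
     ((z / (1 - z * z) - w / (1 - w * w)) * ((1 - z * z) * (1 - w * w)))%C
     by (field; auto).
    rewrite E. ring. }
  replace z with ((z - w) * (1 - (- z) * w) / (1 - (- z) * w) + w)%C by (field; exact Hzw).
  rewrite K. field. exact Hzw.
- intros z Hz Hz0. rewrite (is_C_derive_unique _ _ _ (is_derive_odd_koebe z Hz)).
  pose proof (in_disc_mult z z Hz Hz) as Hzz.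
  pose proof (one_minus_neq_0 _ Hzz) as Hz1.
  unfold odd_koebe. replace (_ / _)%C with ((1 + z * z) / (1 - z * z))%C by (field; auto).
  now apply Re_half_plane_map.
Qed.

Lemma class_A_id : class_A (fun z => z) id_coef.
Proof.
split; [|split; [reflexivity|split; [reflexivity|]]].
- intros z _. eexists. apply is_derive_C_id.
- intros z Hz. pose proof (one_minus_neq_0 z Hz) as Hz1.
  assert (C0 : converges_on_disc id_coef).
  { apply converges_on_disc_bounded. intros n. unfold id_coef.
    destruct (n =? 1)%nat; rewrite ?Cmod_1, ?Cmod_0; lra. }
  replace z with (Csum id_coef z) at 2; [now apply Csum_correct|].
  pose proof (converges_on_disc_shift _ C0) as C1.
  rewrite (Csum_decr _ z C0 Hz), (Csum_decr _ z C1 Hz).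
  rewrite (Csum_constant _ z); [| | exact Hz | reflexivity].
  + unfold Cshift, id_coef; simpl. field. exact Hz1.
  + intros n. unfold Cshift, id_coef; simpl. rewrite Cmod_0. lra.
Qed.

(** With f = g the Koebe function the Caratheodory function is (1 + z) / (1 - z),
    which makes every inequality used for the lower bound on the second
    determinant and for the larger upper bound on the third an equality. *)
Lemma admissible_koebe : admissible koebe koebe_coef koebe koebe_coef.
Proof.
pose proof starlike_koebe as S. split; [exact S|split; [|now split; apply S]].
unfold koebe_coef, standing_ineq. rewrite !Cmod_R. simpl INR. rewrite !Rabs_pos_eq; lra.
Qed.

(** For f = z both determinants are 1. When b_2 = 0 the standing inequality forces
    |b_3| = 1, which rules out g = z; for the odd Koebe function the quotient
    z f' / g is 1 - z^2. *)
Lemma admissible_id_odd_koebe : admissible (fun z => z) id_coef odd_koebe odd_koebe_coef.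
Proof.
split; [exact starlike_odd_koebe|split; [|split; [exact class_A_id|]]].
- unfold odd_koebe_coef, standing_ineq. simpl. rewrite Cmod_0, Cmod_1. lra.
- intros z Hz Hz0. rewrite (is_C_derive_unique (fun w => w) z 1%C (is_derive_C_id z)).
  pose proof (in_disc_mult z z Hz Hz) as Hzz. pose proof (one_minus_neq_0 _ Hzz) as Hz1.
  unfold odd_koebe. replace (_ / _)%C with (1 - z * z)%C by (field; auto).
  unfold in_disc in Hzz. pose proof (Rle_trans _ _ _ (Rle_abs _) (re_le_Cmod (z * z))).
  unfold Cminus. rewrite re_plus, re_opp, re_RtoC. lra.
Qed.

Theorem theorem6 :
  (forall (f : C -> C) (a : nat -> C) (g : C -> C) (b : nat -> C),
    admissible f a g b ->
    (1 - (1 + Cmod (b 2%nat) / 2) ^ 2 <= Re (det_T 2 1 a) <= 1) /\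
    (Phi (Cmod (b 2%nat)) (Cmod (b 3%nat)) - 18 <= 0 ->
       Re (det_T 3 1 a) <= 1) /\
    (Phi (Cmod (b 2%nat)) (Cmod (b 3%nat)) - 18 > 0 ->
       Re (det_T 3 1 a) <= 1 / 18 * Phi (Cmod (b 2%nat)) (Cmod (b 3%nat))))
  /\
  (exists (f : C -> C) (a : nat -> C) (g : C -> C) (b : nat -> C),
    admissible f a g b /\
    Re (det_T 2 1 a) = 1 - (1 + Cmod (b 2%nat) / 2) ^ 2) /\
  (exists (f : C -> C) (a : nat -> C) (g : C -> C) (b : nat -> C),
    admissible f a g b /\ Re (det_T 2 1 a) = 1) /\
  (exists (f : C -> C) (a : nat -> C) (g : C -> C) (b : nat -> C),
    admissible f a g b /\
    Phi (Cmod (b 2%nat)) (Cmod (b 3%nat)) - 18 <= 0 /\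
    Re (det_T 3 1 a) = 1) /\
  (exists (f : C -> C) (a : nat -> C) (g : C -> C) (b : nat -> C),
    admissible f a g b /\
    Phi (Cmod (b 2%nat)) (Cmod (b 3%nat)) - 18 > 0 /\
    Re (det_T 3 1 a) = 1 / 18 * Phi (Cmod (b 2%nat)) (Cmod (b 3%nat))).
Proof.
assert (K2 : Cmod (koebe_coef 2) = 2).
{ unfold koebe_coef. rewrite Cmod_R. simpl. rewrite Rabs_pos_eq; lra. }
assert (K3 : Cmod (koebe_coef 3) = 3).
{ unfold koebe_coef. rewrite Cmod_R. simpl. rewrite Rabs_pos_eq; lra. }
split; [exact hermitian_toeplitz_bounds|].
split; [|split; [|split]].
- exists koebe, koebe_coef, koebe, koebe_coef. split; [exact admissible_koebe|].
  rewrite (det_T_2_1 koebe_coef eq_refl), re_RtoC, K2. lra.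
- exists (fun z => z), id_coef, odd_koebe, odd_koebe_coef.
  split; [exact admissible_id_odd_koebe|].
  rewrite (det_T_2_1 id_coef eq_refl), re_RtoC. unfold id_coef; simpl. rewrite Cmod_0. ring.
- exists (fun z => z), id_coef, odd_koebe, odd_koebe_coef.
  split; [exact admissible_id_odd_koebe|]. split.
  + unfold Phi, odd_koebe_coef; simpl. rewrite Cmod_0, Cmod_1. lra.
  + rewrite (det_T_3_1 id_coef eq_refl), re_RtoC. unfold id_coef; simpl.
    rewrite Cmod_0. ring.
- exists koebe, koebe_coef, koebe, koebe_coef. split; [exact admissible_koebe|].
  rewrite (det_T_3_1 koebe_coef eq_refl), re_RtoC, K2, K3. unfold Phi. split; [lra|].
  unfold koebe_coef; simpl. lra.
Qed.
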